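(* Let $\lambda/\mu$ be a border strip and let $M$ be a positive integer. Then $$s_{\lambda/\mu}(1,q,\ldots,q^{M-1})\;=\;\sum_{\gamma:(\lambda'_1,1)\to(1,\lambda_1),\ \gamma\subseteq[\lambda]} q^{a(\gamma)}\ \sum_{g^1,g^2,\ldots} q^{\sum_{u\in\gamma} g_u\,h(u)},$$ where the outer sum is over lattice paths $\gamma$ of north and east unit steps through cells of $[\lambda]$ from $(\lambda'_1,1)$ to $(1,\lambda_1)$, and, writing $\gamma=\gamma^1,\gamma^2,\ldots$ as the concatenation of its subpaths in the rectangular regions $R_{i_\ell j_\ell}$, the inner sum is over all sequences $g^1,g^2,\ldots$, where $g^\ell$ is an assignment of a nonnegative integer $g_u$ to each cell $u$ of $\gamma^\ell$, such that for every index $i$ of an outer corner of $\lambda$, $$\sum_{\ell:\ i_\ell\ge i,\ j_\ell\le i}\bigl(|g^\ell|+b_\ell\bigr)\le M .$$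
   Context: $[\lambda]=\{(i,j):1\le i\le \ell(\lambda),\,1\le j\le\lambda_i\}$ is the Young diagram (rows numbered from the top, columns from the left), $\lambda'$ is the conjugate partition, and $h(i,j)=\lambda_i-i+\lambda'_j-j+1$ is the hook-length in $\lambda$. A border strip is a connected skew shape $\lambda/\mu$ containing no $2\times2$ box, and here it runs from $(\lambda'_1,1)$ to $(1,\lambda_1)$. $s_{\lambda/\mu}(1,q,\ldots,q^{M-1})$ is the skew Schur function of shape $\lambda/\mu$ evaluated at the $M$ variables $1,q,\ldots,q^{M-1}$. For a path $\gamma$, $a(\gamma)=\sum_{(i,j)\in\gamma}(\lambda'_j-i)$. Let the outer corners of $\lambda$ (cells of $[\lambda]$ with no cell of $[\lambda]$ directly right or directly below) be $(x_1,y_1),\ldots,(x_m,y_m)$, listed from the bottom left, so $x_1>\cdots>x_m$ and $y_1<\cdots<y_m$; set $x_{m+1}=0$, $y_0=0$. The lines through the corners divide $[\lambda]$ into the rectangular regions $R_{ij}=\{(r,c): x_{i+1}<r\le x_i,\ y_{j-1}<c\le y_j\}$, $1\le j\le i\le m$. A path $\gamma$ is divided into consecutive subpaths $\gamma^1,\gamma^2,\ldots$, with $\gamma^\ell$ the part of $\gamma$ lying in a single rectangle $R_{i_\ell j_\ell}$. $|g^\ell|=\sum_{u\in\gamma^\ell}g_u$, and $b_\ell$ is the number of cells of $\gamma^\ell$ from which $\gamma$ takes a north (vertical) step to its next cell.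
   Formalization: The bound on the sum of |g^ℓ|+b_ℓ is M−1 instead of M: as printed the identity fails, e.g. for λ=(1), μ=∅, M=1 the left side is 1 and the right side is 1+q. *)

(* Defs.v *)
From mathcomp Require Import all_boot all_order all_algebra.
From mathcomp Require Import classical_sets fsbigop.

Set Implicit Arguments.
Unset Strict Implicit.
Unset Printing Implicit Defensive.

Import GRing.Theory.
Local Open Scope nat_scope.

(* Partitions are lists of positive parts in weakly decreasing order; rows,
   columns and corner indices are numbered from 1. *)
Definition is_partition (la : seq nat) : bool := sorted geq la && (0 \notin la).

Definition part (la : seq nat) (i : nat) : nat := nth 0 la i.-1.

Definition conj_part (la : seq nat) (j : nat) : nat := count (leq j) la.

Definition cell : Type := (nat * nat)%type.

Definition diagram (la : seq nat) : seq cell :=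
  [seq (i, j) | i <- iota 1 (size la), j <- iota 1 (part la i)].

(* The subtraction is not truncated when u is in the diagram of la. *)
Definition hook (la : seq nat) (u : cell) : nat :=
  (part la u.1 + conj_part la u.2 + 1) - (u.1 + u.2).

Definition skew_cells (la mu : seq nat) : seq cell :=
  [seq u <- diagram la | u \notin diagram mu].

Definition adjacent (u v : cell) : bool :=
  ((u.1 == v.1) && ((u.2 == v.2.+1) || (v.2 == u.2.+1))) ||
  ((u.2 == v.2) && ((u.1 == v.1.+1) || (v.1 == u.1.+1))).

Definition connected_cells (S : seq cell) : Prop :=
  forall u v : cell, u \in S -> v \in S ->
    exists p : seq cell, [/\ path adjacent u p, all (mem S) p & last u p = v].

Definition has_2x2_box (S : seq cell) : Prop :=
  exists i j : nat,
    [/\ (i, j) \in S, (i, j.+1) \in S, (i.+1, j) \in S & (i.+1, j.+1) \in S].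

(* The last two conditions say that the strip runs from the bottom cell of the
   first column of la to the last cell of the first row. *)
Definition border_strip (la mu : seq nat) : Prop :=
  [/\ is_partition la, is_partition mu & {subset diagram mu <= diagram la}] /\
  [/\ connected_cells (skew_cells la mu),
      ~ has_2x2_box (skew_cells la mu),
      (conj_part la 1, 1) \in skew_cells la mu
    & (1, part la 1) \in skew_cells la mu].

Notation filling la mu M := {ffun seq_sub (skew_cells la mu) -> 'I_M}.

Definition semistandard (la mu : seq nat) (M : nat) (T : filling la mu M) :
  bool :=
  [forall u, forall v,
     (((ssval u).1 == (ssval v).1) && ((ssval u).2 < (ssval v).2)
        ==> (T u <= T v)) &&
     (((ssval u).2 == (ssval v).2) && ((ssval u).1 < (ssval v).1)
        ==> (T u < T v))].

(* The skew Schur function s_{la/mu}(x_0, ..., x_{M-1}). *)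
Definition skew_schur (R : comNzRingType) (la mu : seq nat) (M : nat)
    (x : 'I_M -> R) : R :=
  (\sum_(T : filling la mu M | semistandard T) \prod_u x (T u))%R.

Definition ne_step (u v : cell) : bool :=
  ((u.1 == v.1.+1) && (v.2 == u.2)) || ((v.1 == u.1) && (v.2 == u.2.+1)).

Definition lattice_paths (la : seq nat) : set (seq cell) :=
  [set gam | exists p : seq cell,
     [/\ gam = (conj_part la 1, 1) :: p,
         path ne_step (conj_part la 1, 1) p,
         last (conj_part la 1, 1) p = (1, part la 1)
       & {subset gam <= diagram la}]]%classic.

Definition path_area (la : seq nat) (gam : seq cell) : nat :=
  \sum_(u <- gam) (conj_part la u.2 - u.1).

Definition is_outer_corner (la : seq nat) (u : cell) : bool :=
  [&& u \in diagram la, (u.1, u.2.+1) \notin diagram la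
    & (u.1.+1, u.2) \notin diagram la].

(* [diagram la] lists the rows from top to bottom, so the reversal lists the
   corners from the bottom left. *)
Definition outer_corners (la : seq nat) : seq cell :=
  rev [seq u <- diagram la | is_outer_corner la u].

Definition ncorners (la : seq nat) : nat := size (outer_corners la).

(* x_1 > ... > x_m, with x_{m+1} = 0 as the default value of [nth]. *)
Definition corner_row (la : seq nat) (i : nat) : nat :=
  nth 0 [seq u.1 | u <- outer_corners la] i.-1.

(* y_1 < ... < y_m, with y_0 = 0 as the head of the list. *)
Definition corner_col (la : seq nat) (j : nat) : nat :=
  nth 0 (0 :: [seq u.2 | u <- outer_corners la]) j.

Definition in_region (la : seq nat) (i j : nat) (u : cell) : bool :=
  (corner_row la i.+1 < u.1 <= corner_row la i) &&
  (corner_col la j.-1 < u.2 <= corner_col la j).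

(* A path of north and east steps meets each rectangle R_ij in at most one run
   of consecutive cells, so the subpaths gamma^l are exactly the nonempty
   [subpath la gam i j], and are indexed by (i, j) = (i_l, j_l) instead of l. *)
Definition subpath (la : seq nat) (gam : seq cell) (i j : nat) : seq cell :=
  [seq u <- gam | in_region la i j u].

(* An assignment of nonnegative integers to all the cells of gam, i.e. the
   concatenation of the g^l. *)
Notation labelling gam := {ffun seq_sub gam -> nat}.

Definition subpath_weight (la : seq nat) (gam : seq cell) (g : labelling gam)
    (i j : nat) : nat :=
  \sum_(u : seq_sub gam | ssval u \in subpath la gam i j) g u.

(* [infix] is contiguous: the cell following u in gam is the one north of u. *)
Definition steps_north (gam : seq cell) (u : cell) : bool :=
  infix [:: u; (u.1.-1, u.2)] gam.

Definition subpath_norths (la : seq nat) (gam : seq cell) (i j : nat) : nat :=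
  count (steps_north gam) (subpath la gam i j).

(* The bound is M - 1: evaluating at the M variables 1, q, ..., q^{M-1} means
   that the tableau entries, read as exponents of q, are at most M - 1, and the
   sum below is the entry at the k-th corner of the tableau corresponding to
   (gam, g). For a single cell, s(1, q, ..., q^{M-1}) is the sum of the q^g over
   0 <= g <= M - 1. The set is finite, since every cell of the diagram lies in
   some R_ij and hence is counted for some k; sums over it with [\in] are
   therefore not cut off. *)
Definition admissible (la : seq nat) (M : nat) (gam : seq cell) :
  set (labelling gam) :=
  [set g | forall k : nat, 1 <= k <= ncorners la ->
     \sum_(k <= i < (ncorners la).+1) \sum_(1 <= j < k.+1)
        (subpath_weight la g i j + subpath_norths la gam i j) < M]%classic.

Arguments admissible : clear implicits.

Definition hook_weight (la : seq nat) (gam : seq cell) (g : labelling gam) :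
  nat :=
  \sum_(u : seq_sub gam) g u * hook la (ssval u).

(* Main.v *)
Require Import Defs.
From mathcomp Require Import all_boot all_order all_algebra.
From mathcomp Require Import classical_sets fsbigop.
From mathcomp Require Import zify.

(* The border strip is the rim of la. Given a path gam with labels g, put
   A u = g u + [gam goes north from u]. Then T c = \sum A u, over the cells u of
   gam weakly north-west of c, is a tableau on the rim. A cell u of la has hook u
   rim cells weakly south-east of it, so the sum of T is \sum A u * hook u, and the
   hooks of the cells left by a north step add up to the area of gam. At the k-th
   corner T is the k-th sum bounded in [admissible], and T is column-strict because
   gam leaves every row but the first by a north step, from a cell with A > 0.
   Conversely T c = C c.2 - D c.1 on the rim, where C j (resp. D i) is the sum of
   A over the columns up to j (resp. the rows below i); these cumulative sums can
   be read off T. The pair (gam, A) is the south-west corner rule for these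
   margins: from (i, j) the path goes north iff D (i-1) <= C j, and A (i, j) is
   the length of the intersection of [D i, D (i-1)] and [C (j-1), C j]. *)

Set Implicit Arguments.
Unset Strict Implicit.
Unset Printing Implicit Defensive.

(** * Diagrams, conjugate partitions and the rim *)

Lemma mem_diagram la (u : cell) :
  (u \in diagram la) = [&& 0 < u.1, 0 < u.2 & u.2 <= part la u.1].
Proof.
case: u => i j /=; apply/allpairsPdep/idP => /=.
  move=> [i' [j' [+ + [-> ->]]]]; rewrite !mem_iota; lia.
move=> /and3P[i0 j0 lej]; exists i, j; rewrite !mem_iota; split => //; last by lia.
have: i.-1 < size la; last by lia.
by rewrite ltnNge; apply/negP => /(nth_default 0); rewrite -/(part la i); lia.
Qed.

(** Both sides say that [(i, j)] is a cell of the diagram; passages between rows and columns go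
    through this equivalence. *)
Lemma leq_part_conj la i j : is_partition la -> 0 < i -> 0 < j ->
  (j <= part la i) = (i <= conj_part la j).
Proof.
move=> /andP[srt _] + j0; rewrite /part /conj_part; case: i => // i _ /=.
elim: la srt i => [|x s IHs] /= srt i; first by rewrite nth_nil; lia.
move: srt; rewrite (@path_sortedE _ geq) => [|a b c /= + +]; last by lia.
move=> /andP[/allP sx /IHs{}IHs].
case: i => [|i] /=; last first.
  rewrite IHs; case: (leqP j x) => //= xj; rewrite add0n.
  (* The parts after [x] are at most [x], hence below [j]. *)
  suff -> : count (leq j) s = 0 by [].
  by apply/eqP; rewrite -leqn0 leqNgt -has_count; apply/hasPn => y /sx /=; lia.
case: (leqP j x) => //= xj; rewrite add0n.
suff -> : count (leq j) s = 0 by [].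
by apply/eqP; rewrite -leqn0 leqNgt -has_count; apply/hasPn => y /sx /=; lia.
Qed.

Definition rim la (u : cell) : bool :=
  (u \in diagram la) && ((u.1.+1, u.2.+1) \notin diagram la).

Lemma mem_rim la (u : cell) :
  rim la u = [&& 0 < u.1, 0 < u.2, u.2 <= part la u.1 & part la u.1.+1 <= u.2].
Proof. by rewrite /rim !mem_diagram /=; lia. Qed.

Section Partition.
Variable la : seq nat.
Hypothesis la_part : is_partition la.

Lemma part_anti i i' : 0 < i -> i <= i' -> part la i' <= part la i.
Proof.
move=> i0 ii'; case: (posnP (part la i')) => [->//|p0].
have i'0 : 0 < i' by lia.
by have := leqnn (part la i'); rewrite !(leq_part_conj la_part _ p0) //; lia.
Qed.

Lemma conj_anti j j' : 0 < j -> j <= j' -> conj_part la j' <= conj_part la j.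
Proof.
move=> j0 jj'; case: (posnP (conj_part la j')) => [->//|p0].
have j'0 : 0 < j' by lia.
by have := leqnn (conj_part la j'); rewrite -!(leq_part_conj la_part p0) //; lia.
Qed.

Lemma diagram_down (u v : cell) : v \in diagram la -> 0 < u.1 <= v.1 ->
  0 < u.2 <= v.2 -> u \in diagram la.
Proof.
rewrite !mem_diagram => /and3P[_ _ vin] /andP[u1 uv1] uv2.
by have := part_anti u1 uv1; lia.
Qed.

Lemma rim_conj (u : cell) :
  rim la u = [&& 0 < u.1, 0 < u.2, u.1 <= conj_part la u.2
                & conj_part la u.2.+1 <= u.1].
Proof.
rewrite /rim !mem_diagram /=; case: (posnP u.1) => //= u1.
by case: (posnP u.2) => //= u2; rewrite !leq_part_conj //; lia.
Qed.

End Partition.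

(** * Border strips are rims *)

Lemma path_discrete_ivt (e : rel cell) (f : cell -> int) (k : int) u p :
    (forall v w, e v w -> (f w <= f v + 1)%R) ->
    path e u p -> (f u <= k)%R -> (k <= f (last u p))%R ->
  exists2 w : cell, w \in u :: p & f w = k.
Proof.
move=> fe; elim: p u => [|v p IHp] u /=.
  by move=> _ uk ku; exists u; rewrite ?mem_head //; lia.
move=> /andP[/fe uv vp] uk kl.
have [<-|uk'] := eqVneq (f u) k; first by exists u; rewrite ?mem_head.
have [w wp fw] : exists2 w : cell, w \in v :: p & f w = k by apply: IHp => //; lia.
by exists w => //; rewrite inE wp orbT.
Qed.

(** A strip cell with its south-east diagonal neighbour in [la] would start a 2x2 box. Conversely, a
    connected strip joining the two ends meets every diagonal in between, and a diagonal holds only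
    one rim cell. *)
Lemma border_strip_rim la mu : border_strip la mu -> skew_cells la mu =i rim la.
Proof.
move=> [[la_part mu_part mula] [conn no22 c0 c1]].
have skewE (u : cell) : (u \in skew_cells la mu) = (u \in diagram la) && (u \notin diagram mu).
  by rewrite mem_filter andbC.
have sub (u : cell) : u \in skew_cells la mu -> rim la u.
  rewrite skewE => /andP[ula umu]; rewrite /rim ula /=; apply/negP => vla.
  have [u1 u2] : 0 < u.1 /\ 0 < u.2 by move: ula; rewrite mem_diagram; lia.
  apply: no22; exists u.1, u.2.
  (* The square from [u] to its diagonal neighbour avoids [mu] because [u] does. *)
  have H (v : cell) : v.1 <= u.1.+1 -> v.2 <= u.2.+1 -> u.1 <= v.1 -> u.2 <= v.2 ->
      v \in skew_cells la mu.
    move=> *; rewrite skewE (diagram_down la_part vla) /=; try lia.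
    by apply: contra umu => /(diagram_down mu_part); apply; lia.
  by split; apply: H => /=; lia.
suff sup (c : cell) : rim la c -> c \in skew_cells la mu.
  by move=> c; apply/idP/idP; [apply: sub | apply: sup].
move=> cr.
have [p [pp pS pl]] := conn _ _ c0 c1.
(* The content, which numbers the diagonals and differs by 1 between adjacent cells. *)
pose f (w : cell) : int := (w.2%:Z - w.1%:Z)%R.
have := cr; rewrite mem_rim => /and4P[c10 c20 cle _].
have c1L : c.1 <= conj_part la c.2 by rewrite -leq_part_conj.
have := conj_anti la_part (isT : 0 < 1) c20.
have := part_anti la_part (isT : 0 < 1) c10 => ? ?.
have [|||w wp fw] := @path_discrete_ivt adjacent f (f c) _ _ _ pp.
- by move=> v w; rewrite /adjacent /f; lia.
- by rewrite /f /=; lia.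
- by rewrite pl /f /=; lia.
have /[dup] /sub wr : w \in skew_cells la mu.
  by move: wp; rewrite inE => /predU1P[->//|/(allP pS)].
suff -> : w = c by [].
move: wr cr fw; rewrite /rim /f => /andP[wl wl'] /andP[cl cl'] fw.
(* Of two rim cells on one diagonal, the lower would force the south-east neighbour of the higher
   into [la]. *)
apply/eqP; rewrite -pair_eqE /pair_eq; case: (ltngtP w.1 c.1) => wc; last by rewrite /=; apply/eqP; clear f; lia.
- by case/negP: wl'; apply: (diagram_down la_part cl) => /=; lia.
- by case/negP: cl'; apply: (diagram_down la_part wl) => /=; lia.
Qed.

(** * Cumulative sums of labels along a path *)

Definition cols_sum (gam : seq cell) (A : cell -> nat) (j : nat) :=
  \sum_(v <- gam | v.2 <= j) A v.

Definition rows_sum (gam : seq cell) (A : cell -> nat) (i : nat) :=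
  \sum_(v <- gam | i < v.1) A v.

Definition quadrant_sum (gam : seq cell) (A : cell -> nat) (c : cell) :=
  \sum_(v <- gam | (v.1 <= c.1) && (v.2 <= c.2)) A v.

(** A cell of [la] below row [c.1] cannot be to the right of column [c.2], as the diagonal neighbour
    of [c] is outside [la]. So the columns up to [c.2] contain all the rows below [c.1], and the
    quadrant is what remains. *)
Lemma quadrant_sumE la gam A (c : cell) : is_partition la ->
  {subset gam <= diagram la} -> rim la c ->
  quadrant_sum gam A c + rows_sum gam A c.1 = cols_sum gam A c.2.
Proof.
move=> la_part gam_la /andP[cla cla'].
rewrite /cols_sum (bigID (fun v : cell => v.1 <= c.1)) /=; congr addn.
  by apply: eq_bigl => v; rewrite andbC.
have vc (v : cell) : v \in gam -> (c.1 < v.1) = (v.2 <= c.2) && (c.1 < v.1).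
  move=> vgam; case: ltnP => cv; rewrite ?andbF // andbT; symmetry.
  rewrite leqNgt; apply: contra cla' => cv'.
  by apply: (diagram_down la_part (gam_la _ vgam)) => /=; lia.
rewrite /rows_sum big_seq_cond [RHS]big_seq_cond; apply: eq_bigl => v.
have [/vc vc'|//] := boolP (v \in gam); rewrite /= -ltnNge; exact: vc'.
Qed.

(** * North-east paths and the corner rule *)

Lemma ne_path_mono (u v : cell) p : path ne_step u p -> v \in u :: p ->
  (v.1 <= u.1) && (u.2 <= v.2).
Proof.
elim: p u => [|w p IHp] u /=; first by rewrite inE => _ /eqP->; lia.
move=> /andP[uw wp]; rewrite inE => /predU1P[->|/(IHp _ wp)]; first by lia.
by move: uw; rewrite /ne_step; lia.
Qed.

Lemma ne_path_uniq (u : cell) p : path ne_step u p -> uniq (u :: p).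
Proof.
elim: p u => [|w p IHp] u //= /andP[uw wp]; have /= -> := IHp _ wp.
rewrite andbT; apply/negP => /(ne_path_mono wp).
by move: uw; rewrite /ne_step; lia.
Qed.

(* In a tie D (i-1) = C j the path must go north: after an east step it would
   leave row i from a cell with A = 0. *)
Definition next_cell (C D : nat -> nat) (u : cell) : cell :=
  if (1 < u.1) && (D u.1.-1 <= C u.2) then (u.1.-1, u.2) else (u.1, u.2.+1).

(** Truncated subtraction gives 0 for disjoint intervals. *)
Definition overlap (C D : nat -> nat) (u : cell) : nat :=
  minn (C u.2) (D u.1.-1) - maxn (C u.2.-1) (D u.1).

Lemma next_cell_step C D u : ne_step u (next_cell C D u).
Proof. by rewrite /ne_step /next_cell; case: ifP => /=; lia. Qed.

Lemma fpath_ne C D u p : fpath (next_cell C D) u p -> path ne_step u p.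
Proof. by apply: sub_path => v w /= /eqP<-; apply: next_cell_step. Qed.

Section Walk.
Variable la : seq nat.
Hypothesis la_part : is_partition la.
Let L := conj_part la 1.
Let N := part la 1.

(** What the margins of a tableau on the rim satisfy: the strict descent of [D] reflects
    column-strictness, the growth of [C] the weak increase along rows, and the last condition the
    nonnegative entries. From [D 0] to [D 1] the descent may be weak, since no north step leaves row
    1. *)
Definition profile (C D : nat -> nat) : Prop :=
  [/\ C 0 = 0, D L = 0 & C N = D 0] /\
  [/\ forall i, 1 < i <= L -> D i < D i.-1, D 1 <= D 0,
      forall j, j < N -> C j <= C j.+1 &
      forall c, rim la c -> D c.1 <= C c.2].

(** The invariant of the walk: the intervals of row [u.1] and column [u.2] meet. One inequality is
    strict because ties are resolved northwards. *)
Definition visited (C D : nat -> nat) (u : cell) : bool :=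
  [&& u \in diagram la, D u.1 <= C u.2 & (u.1 == 1) || (C u.2.-1 < D u.1.-1)].

Lemma diagram_box (u : cell) : u \in diagram la ->
  [&& 0 < u.1, u.1 <= L, 0 < u.2 & u.2 <= N].
Proof.
rewrite mem_diagram => /and3P[u1 u2 uin].
have := part_anti la_part (isT : 0 < 1) u1; rewrite -/N.
have := conj_anti la_part (isT : 0 < 1) u2; rewrite -/L.
have := uin; rewrite leq_part_conj //; lia.
Qed.

Variables C D : nat -> nat.
Hypothesis CD : profile C D.

Lemma visited_next (u : cell) : visited C D u -> u != (1, N) ->
  visited C D (next_cell C D u).
Proof.
case: CD => -[C0 DL CN] [Dd D01 Cm CDrim] /and3P[ula Du Cu] uend.
have /and4P[u1 uL u2 uN] := diagram_box ula.
rewrite /next_cell; case: ifP => [/andP[lt1u north]|east].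
  have vla : (u.1.-1, u.2) \in diagram la.
    by apply: (diagram_down la_part ula) => /=; lia.
  rewrite /visited vla /= north /=; have [//|u1n1] := eqVneq u.1.-1 1.
  have := Dd u.1.-1; lia.
have vla : (u.1, u.2.+1) \in diagram la.
  move: (ula); rewrite !mem_diagram u1 u2 /= => up.
  rewrite ltnNge; apply/negP => pu; case: (ltngtP u.1 1) => u11; first by lia.
    (* If the east neighbour were outside [la], the cell north of [u] would be on the rim, and
       [CDrim] would have sent the walk north. *)
    have := CDrim (u.1.-1, u.2).
    rewrite mem_rim /= prednK // pu; have := @part_anti _ la_part u.1.-1 u.1.
    lia.
  case/negP: uend; apply/eqP; rewrite [u]surjective_pairing u11; congr pair.
  by move: pu; rewrite u11 -/N; lia.
have := diagram_box vla; have := Cm u.2.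
rewrite /visited vla /=; lia.
Qed.

(** The overlaps along the walk are the lengths of consecutive intervals: each step moves to the
    interval that begins where the current one ends. The [maxn] term is the left end of the interval
    at [u], that is, what was used up before [u]. *)
Lemma walk_sums (u : cell) (p : seq cell) : fpath (next_cell C D) u p -> last u p = (1, N) ->
  all (visited C D) (u :: p) ->
  (forall i, i < u.1 ->
     rows_sum (u :: p) (overlap C D) i + maxn (C u.2.-1) (D u.1) = D i) /\
  (forall j, u.2 <= j <= N ->
     cols_sum (u :: p) (overlap C D) j + maxn (C u.2.-1) (D u.1) = C j).
Proof.
case: CD => -[C0 DL CN] [Dd D01 Cm CDrim].
have CmN j : j <= N -> C j <= C N.
  elim: {j}(N - j) {-2}j (erefl (N - j)) => [|k IHk] j jk jN.
    by rewrite (_ : j = N) //; lia.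
  by apply: leq_trans (Cm j _) (IHk _ _ _); lia.
rewrite /rows_sum /cols_sum; elim: p u => [|v p IHp] u.
  move=> _ /= -> /andP[/and3P[/diagram_box/= box _ _] _].
  have := Cm N.-1; rewrite prednK; last by lia.
  move=> CN1; split=> [i|j]; rewrite big_cons big_nil /overlap /=.
    by move=> i1; rewrite i1 (_ : i = 0); lia.
  by move=> jN; rewrite (_ : j = N) ?leqnn; lia.
move=> /= /andP[/eqP uv vp] pl /andP[uvis vis].
have [IHr IHc] := IHp _ vp pl vis; have mono := ne_path_mono (fpath_ne vp).
case/and3P: uvis => /diagram_box box Du Cu.
have /= := Cm u.2.-1; rewrite prednK; last by lia.
move=> Cu1; have Du1 := Dd u.1.
have ov : overlap C D u = minn (C u.2) (D u.1.-1) - maxn (C u.2.-1) (D u.1) by [].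
split=> [i|j].
  rewrite big_cons ov => iu; rewrite iu.
  move: uv IHr mono; rewrite /next_cell; case: ifP => north <- /= IHr mono.
    have [iu1|iu1] := ltnP i u.1.-1; first by have := IHr _ iu1; lia.
    rewrite big_seq_cond big_pred0 => [|w]; last first.
      by apply/negP => /andP[/mono /=]; lia.
    by rewrite (_ : i = u.1.-1); lia.
  have := IHr _ iu; have := CmN u.2.
  by have [u11|u11] := eqVneq u.1 1; rewrite ?u11 /= in north Du1 *; lia.
rewrite big_cons ov => uj; have -> : u.2 <= j by lia.
move: uv IHc mono; rewrite /next_cell; case: ifP => north <- /= IHc mono.
  by have := IHc _ uj; lia.
(* In row 1 the east step is forced, and [D 0 = C N] bounds [C u.2]. *)
have D_C : C u.2 <= D u.1.-1.
  have := CmN u.2.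
  by have [u11|u11] := eqVneq u.1 1; rewrite ?u11 /= in north *; lia.
have [iu1|iu1] := ltnP u.2 j; first by have := IHc j; lia.
rewrite big_seq_cond big_pred0 => [|w]; last first.
  by apply/negP => /andP[/mono /=]; lia.
rewrite (_ : j = u.2); lia.
Qed.

(** Each step lowers [u.1 - u.2] by one, and within the box of [la] only [(1, N)] attains the least
    value. *)
Lemma walk_ends m (u : cell) : visited C D u -> u.1 + N = m.+1 + u.2 ->
  let p := traject (next_cell C D) (next_cell C D u) m in
  last u p = (1, N) /\ all (visited C D) (u :: p).
Proof.
elim: m u => [|m IHm] u uvis um /=; have /and3P[/diagram_box box _ _] := uvis.
  rewrite uvis [u]surjective_pairing; split=> //; congr pair; lia.
have uend : u != (1, N) by apply/eqP => uE; rewrite uE /= in um; lia.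
rewrite uvis; apply: IHm; first exact: visited_next.
have := next_cell_step C D u; rewrite /ne_step; lia.
Qed.

End Walk.

(** * A labelled path follows the corner rule of its margins *)

Lemma rows_sum_anti gam A i i' : i <= i' -> rows_sum gam A i' <= rows_sum gam A i.
Proof.
move=> ii'; rewrite /rows_sum [leqRHS](bigID (fun v : cell => i' < v.1)) /=.
apply: leq_trans (leq_addr _ _); rewrite leq_eqVlt; apply/orP; left; apply/eqP.
by apply: eq_bigl => v; lia.
Qed.

(** The path leaves row [i.+1] by a north step, from a cell with positive label that only the larger
    sum counts. *)
Lemma rows_sum_lt A i (u : cell) p : path ne_step u p -> (last u p).1 <= i ->
  path (fun v w => (w.1 < v.1) ==> (0 < A v)) u p -> i < u.1 ->
  rows_sum (u :: p) A i.+1 < rows_sum (u :: p) A i.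
Proof.
elim: p u => [|v p IHp] u /=; first by lia.
move=> /andP[uv vp] pl /andP[Au vA] iu.
have := IHp _ vp pl vA; have := rows_sum_anti (v :: p) A (leqnSn i).
rewrite /rows_sum !(big_cons _ _ u) iu.
by move: uv Au; rewrite /ne_step; case: (ltnP i.+1 u.1); lia.
Qed.

Lemma ne_path_size (u : cell) p : path ne_step u p ->
  u.1 + (last u p).2 = (last u p).1 + u.2 + size p.
Proof.
elim: p u => [|v p IHp] u /=; first by lia.
by move=> /andP[+ /IHp]; rewrite /ne_step; lia.
Qed.

(** Induction along the path, where [b] stands for the labels of the cells already left. Before a
    north step, the rows from [u.1] down are finished, so [D u.1.-1] is [b + A u]; before an east
    step, column [u.2] is finished, so [C u.2] is. In both cases [b + A u] is the right end of the
    interval at [u]. *)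
Lemma walk_unique (A : cell -> nat) (N b : nat) (C D : nat -> nat)
    (u : cell) (p : seq cell) :
    path ne_step u p -> last u p = (1, N) ->
    path (fun v w => (w.1 < v.1) ==> (0 < A v)) u p ->
    (forall v : cell, v \in u :: p -> 0 < v.1) ->
    (forall i, i < u.1 -> D i = b + rows_sum (u :: p) A i) ->
    (forall j, u.2 <= j <= N -> C j = b + cols_sum (u :: p) A j) ->
    b = maxn (C u.2.-1) (D u.1) ->
  fpath (next_cell C D) u p /\ {in u :: p, overlap C D =1 A}.
Proof.
elim: p u b => [|v p IHp] u b.
  move=> _ /= -> /= _ _ HD HC bE; split=> // w; rewrite inE => /eqP->.
  have := HD 0 isT; have := HC N.
  rewrite /rows_sum /cols_sum !big_cons !big_nil /= leqnn /overlap /=; lia.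
move=> /andP[uv vp] pl /andP[Au vA] pos HD HC bE.
have mono := ne_path_mono vp.
have posv (w : cell) : w \in v :: p -> 0 < w.1 by move=> wp; apply: pos; rewrite inE wp orbT.
have u10 : 0 < u.1 := pos _ (mem_head _ _).
have v10 : 0 < v.1 := posv _ (mem_head _ _).
have vl := mono _ (mem_last v p); rewrite /= in pl.
rewrite pl /= in vl.
have HDu i : i < u.1 -> D i = b + A u + rows_sum (v :: p) A i.
  by move=> iu; rewrite HD // /rows_sum big_cons iu; lia.
have HCu j : u.2 <= j <= N -> C j = b + A u + cols_sum (v :: p) A j.
  move=> uj; rewrite HC // /cols_sum big_cons.
  by case/andP: uj => -> _; lia.
have [] : v = (u.1.-1, u.2) \/ v = (u.1, u.2.+1).
- move: uv; rewrite /ne_step => /orP[] /andP[/eqP e1 /eqP e2]; [left|right].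
    by rewrite [v]surjective_pairing -e2 e1.
  by rewrite [v]surjective_pairing e1 e2.
- move=> vE; have Apos : 0 < A u by move: Au; rewrite vE /=; move: v10; rewrite vE /=; lia.
  have D1 : D u.1.-1 = b + A u.
    rewrite HDu; last by lia.
    rewrite /rows_sum big_seq_cond big_pred0 ?addn0 // => w.
    by apply/negP => /andP[/mono]; rewrite vE /=; lia.
  have C1 := HCu u.2.
  have nu : next_cell C D u = v.
    by rewrite /next_cell vE ifT //; move: v10 vl; rewrite vE /=; lia.
  have [|||||||pv ov] := IHp v (b + A u) => //.
  + by move=> i iv; apply: HDu; move: iv; rewrite vE /=; lia.
  + by move=> j vj; apply: HCu; move: vj; rewrite vE.
  + by rewrite vE /= D1; lia.
  split; first by rewrite /= nu eqxx.
  move=> w; rewrite inE => /predU1P[->|]; last exact: ov.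
  by rewrite /overlap; rewrite vE /= in vl; lia.
- move=> vE; have C1 : C u.2 = b + A u.
    rewrite HCu; last by move: vl; rewrite vE /=; lia.
    rewrite /cols_sum big_seq_cond big_pred0 ?addn0 // => w.
    by apply/negP => /andP[/mono]; rewrite vE /=; lia.
  have D1 : D u.1.-1 = b + A u + rows_sum (v :: p) A u.1.-1 by apply: HDu; lia.
  have nu : next_cell C D u = v.
    rewrite /next_cell vE; case: ifP => // /andP[u1].
    (* Row [u.1] is still to be left northwards from a cell with positive label, so [D u.1.-1]
       exceeds [C u.2]. *)
    suff : 0 < rows_sum (v :: p) A u.1.-1 by lia.
    by apply: leq_ltn_trans (rows_sum_lt vp _ vA _); rewrite ?pl ?vE /=; lia.
  have [|||||||pv ov] := IHp v (b + A u) => //.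
  + by move=> i iv; apply: HDu; move: iv; rewrite vE /=; lia.
  + by move=> j vj; apply: HCu; move: vj; rewrite vE /=; lia.
  + by rewrite vE /= C1; lia.
  split; first by rewrite /= nu eqxx.
  move=> w; rewrite inE => /predU1P[->|]; last exact: ov.
  by rewrite /overlap; lia.
Qed.

(** * Reading the margins off a tableau *)

(** The label sum of row [k]: the last cell of the row and the cell above it share the term [C], so
    their entries differ by [D k.-1 - D k]. Above row 1 there is no cell, and the entry is replaced
    by 0. *)
Definition row_diff la (t : cell -> nat) (k : nat) : nat :=
  t (k, part la k) - (if k == 1 then 0 else t (k.-1, part la k)).

Definition row_profile la (t : cell -> nat) (i : nat) : nat :=
  \sum_(i.+1 <= k < (conj_part la 1).+1) row_diff la t k.

(** The equation T = C - D, solved for C at the bottom cell of column [j]. *)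
Definition col_profile la (t : cell -> nat) (j : nat) : nat :=
  if j == 0 then 0
  else t (conj_part la j, j) + row_profile la t (conj_part la j).

Definition rim_tableau la (t : cell -> nat) : Prop :=
  (forall i j, rim la (i, j) -> rim la (i, j.+1) -> t (i, j) <= t (i, j.+1)) /\
  (forall i j, rim la (i, j) -> rim la (i.+1, j) -> t (i, j) < t (i.+1, j)).

Section Tableau.
Variable la : seq nat.
Hypothesis la_part : is_partition la.
Hypothesis la_gt0 : 0 < part la 1.
Let L := conj_part la 1.
Let N := part la 1.

Lemma row_profile_rec t k : 0 < k <= L ->
  row_profile la t k.-1 = row_diff la t k + row_profile la t k.
Proof. by move=> kL; rewrite /row_profile big_ltn prednK //; lia. Qed.

Lemma row_end_rim k : 1 < k <= L ->
  rim la (k, part la k) && rim la (k.-1, part la k).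
Proof.
move=> kL; rewrite !mem_rim /= prednK; last by lia.
have := @part_anti _ la_part k.-1 k; have := @part_anti _ la_part k k.+1.
by have := @leq_part_conj _ k 1 la_part; rewrite -/L; lia.
Qed.

Lemma first_row_end_rim : rim la (1, N).
Proof. by rewrite mem_rim /= la_gt0 leqnn part_anti. Qed.

(** Induction up the column from its bottom cell. Two rim cells [(i, j)] and [(i.+1, j)] force row
    [i.+1] to end in column [j], so [row_diff] compares exactly their entries. *)
Lemma tableau_profileE t (c : cell) : rim_tableau la t -> rim la c ->
  t c + row_profile la t c.1 = col_profile la t c.2.
Proof.
move=> [_ tcol]; case: c => i j.
rewrite (rim_conj la_part) => /= /and4P[i0 j0 + ij'].
elim: {i}(_ - i) {-2}i (erefl (conj_part la j - i)) i0 ij' => [|n IHn] i + i0 ij' ij.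
  move=> ijn; have -> : i = conj_part la j by lia.
  by rewrite /col_profile; case: eqP => //; lia.
move=> ijn; rewrite -(IHn i.+1) //; try lia.
have -> : row_profile la t i = row_diff la t i.+1 + row_profile la t i.+1.
  by rewrite -row_profile_rec //; have := conj_anti la_part (isT : 0 < 1) j0; lia.
have ri : rim la (i, j) by rewrite rim_conj //=; lia.
have ri1 : rim la (i.+1, j) by rewrite rim_conj //=; lia.
have pj : part la i.+1 = j.
  by move: ri ri1; rewrite !mem_rim /=; lia.
have := tcol _ _ ri ri1; rewrite /row_diff pj /=; case: eqP; lia.
Qed.

Lemma tableau_profile t : rim_tableau la t ->
  profile la (col_profile la t) (row_profile la t).
Proof.
move=> tt; have tE := tableau_profileE tt; have [trow tcol] := tt.
have L0 : 0 < L by rewrite -leq_part_conj.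
split; split=> //.
- by rewrite /row_profile big_geq.
- have := tE _ first_row_end_rim; have := @row_profile_rec t 1.
  by rewrite /row_diff /= -/N; lia.
- move=> i iL; rewrite row_profile_rec; last by lia.
  have /andP[r1 r2] := row_end_rim iL; have := @tcol i.-1 (part la i).
  by rewrite prednK ?r1 ?r2 /row_diff; [case: eqP|]; lia.
- by rewrite (@row_profile_rec t 1) ?leq_addl.
- case=> [|j] jN //.
  (* The bottom row of column [j.+2] has rim cells in both columns [j.+1] and [j.+2]. *)
  have [i iE] : exists i, i = conj_part la j.+2 by eexists.
  have i0 : 0 < i by rewrite iE -leq_part_conj.
  have := conj_anti la_part (isT : 0 < j.+1) (leqnSn _).
  have := conj_anti la_part (isT : 0 < j.+2) (leqnSn _) => ij ij2.
  have r1 : rim la (i, j.+1) by rewrite rim_conj //=; lia.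
  have r2 : rim la (i, j.+2) by rewrite rim_conj //=; lia.
  by have := trow _ _ r1 r2; have := tE _ r1; have := tE _ r2; rewrite /=; lia.
- by move=> c /tE <-; rewrite leq_addl.
Qed.

(** Hence the margins of a labelled path depend only on its tableau. The rows are treated from [L],
    where both sides are 0, upwards. *)
Lemma quadrant_sum_profile t (gam : seq cell) A : {subset gam <= diagram la} ->
    (forall c, rim la c -> t c = quadrant_sum gam A c) ->
  (forall i, i <= L -> row_profile la t i = rows_sum gam A i) /\
  (forall j, j <= N -> col_profile la t j = cols_sum gam A j).
Proof.
move=> gam_la tA.
have tE c : rim la c -> t c + rows_sum gam A c.1 = cols_sum gam A c.2.
  by move=> rc; rewrite tA //; apply: (@quadrant_sumE la).
have box (v : cell) : v \in gam -> [&& 0 < v.1, v.1 <= L, 0 < v.2 & v.2 <= N].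
  by move=> /gam_la /(diagram_box la_part).
have rowE i : i <= L -> row_profile la t i = rows_sum gam A i.
  elim: {i}(L - i) {-2}i (erefl (L - i)) => [|n IHn] i iLn iL.
    rewrite /row_profile big_geq; last by lia.
    rewrite /rows_sum big_seq_cond big_pred0 // => v.
    by apply/negP => /andP[/box]; lia.
  rewrite (@row_profile_rec t i.+1) ?IHn /row_diff; try lia.
  have [->|i0] := eqVneq i 0.
    (* The columns up to [N] and the rows below 0 both comprise the whole path. *)
    have := tE _ first_row_end_rim; rewrite /= subn0 => ->.
    rewrite /cols_sum /rows_sum [LHS]big_seq_cond [RHS]big_seq_cond.
    apply: eq_bigl => v; case vgam: (v \in gam) => //=.
    by have := box _ vgam; lia.
  have iL2 : 1 < i.+1 <= L by lia.
  have /andP[/tE r1 /tE r2] := row_end_rim iL2.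
  have := rows_sum_anti gam A (leqnSn i).
  by case: eqP => [|_]; move: r1 r2; rewrite /=; lia.
split=> // j jN; rewrite /col_profile; case: eqP => [->|/eqP j0].
  rewrite /cols_sum big_seq_cond big_pred0 // => v.
  by apply/negP => /andP[/box]; lia.
have j0' : 0 < j by lia.
have := conj_anti la_part (isT : 0 < 1) j0'; rewrite -/L => jL.
rewrite rowE //; apply: (tE (conj_part la j, j)).
rewrite rim_conj //= leqnn j0' conj_anti //.
by rewrite -leq_part_conj // jN.
Qed.

End Tableau.

(** * Hooks as counts of rim cells *)

Lemma pair_allpairs_uniq (s : seq nat) (t : nat -> seq nat) :
  uniq s -> (forall i, uniq (t i)) -> uniq [seq (i, j) | i <- s, j <- t i].
Proof.
move=> us ut; apply: allpairs_uniq_dep => //.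
by move=> [i j] [i' j'] _ _ /= [-> ->].
Qed.

Lemma diagram_uniq la : uniq (diagram la).
Proof. by apply: pair_allpairs_uniq => [|i]; apply: iota_uniq. Qed.

Lemma skew_cells_uniq la mu : uniq (skew_cells la mu).
Proof. exact/filter_uniq/diagram_uniq. Qed.

(** The summand is the number of rim cells of column [k] weakly below row [i]. Consecutive columns
    share a boundary row, so the sum telescopes up to one unit per column; it stops at the end of
    row [i], where the [maxn] becomes [i]. *)
Lemma sum_column_heights la i j n : is_partition la -> 0 < i -> 0 < j ->
  part la i = (j + n).-1 ->
  \sum_(k <- iota j n) ((conj_part la k).+1 - maxn i (conj_part la k.+1)) + i =
  maxn i (conj_part la j) + n.
Proof.
move=> la_part i0; elim: n j => [|n IHn] j j0 pi.
  by rewrite big_nil; have := leq_part_conj la_part i0 j0; lia.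
rewrite (_ : iota j n.+1 = j :: iota j.+1 n) // big_cons.
have := IHn j.+1 isT; rewrite addSnnS => /(_ pi).
have := conj_anti la_part j0 (leqnSn j).
by have := leq_part_conj la_part i0 j0; lia.
Qed.

Lemma count_rim_hook la S (u : cell) : is_partition la -> uniq S ->
    S =i rim la -> u \in diagram la ->
  count (fun c : cell => (u.1 <= c.1) && (u.2 <= c.2)) S = hook la u.
Proof.
move=> la_part uS S_rim.
rewrite mem_diagram => /and3P[u1 u2 up].
have SE c : (c \in S) = rim la c := S_rim c.
pose n := (part la u.1).+1 - u.2.
(* The rows of the rim cells in column [k] weakly below [u]; the pairs in [s] are (column, row). *)
pose t k := iota (maxn u.1 (conj_part la k.+1))
  ((conj_part la k).+1 - maxn u.1 (conj_part la k.+1)).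
pose s := [seq (k, i) | k <- iota u.2 n, i <- t k].
have us : uniq s by apply: pair_allpairs_uniq => [|k]; apply: iota_uniq.
have -> : count (fun c : cell => (u.1 <= c.1) && (u.2 <= c.2)) S = size s.
  rewrite -size_filter -(size_map (fun c : cell => (c.2, c.1))).
  apply: perm_size.
  apply: uniq_perm => //.
    by rewrite map_inj_uniq ?filter_uniq // => -[a b] [a' b'] /= [-> ->].
  move=> [j i].
  apply/idP/idP => [/mapP[[i' j'] + [-> ->]]|/allpairsPdep[j' [i' [+ + [-> ->]]]]].
    rewrite mem_filter => /andP[/= uc]; rewrite SE rim_conj //= => H.
    apply/allpairsPdep; exists j', i'; rewrite /t !mem_iota /n; split=> //; last by lia.
    by have := @leq_part_conj la u.1 j' la_part u1; lia.
  rewrite /t !mem_iota /n => j'n i'n; apply/mapP; exists (i', j') => //.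
  rewrite mem_filter SE rim_conj //=.
  by have := @leq_part_conj la u.1 j' la_part u1; lia.
rewrite size_allpairs_dep sumnE big_map.
under eq_bigr do rewrite size_iota.
have := @sum_column_heights la u.1 u.2 n la_part u1 u2; rewrite /hook.
have := leq_part_conj la_part u1 u2; rewrite /n; lia.
Qed.

(** * The area under a path *)

(** Counts the cells of [la] strictly below row [u.1], from column [u.2] on. *)
Definition below_area la (u : cell) : nat :=
  \sum_(u.2 <= k < (part la 1).+1) (conj_part la k - u.1).

Lemma sum_leq_nat a m n : \sum_(m <= k < n) (k <= a) = minn a.+1 n - m.
Proof.
elim: n => [|n IHn]; first by rewrite big_geq ?minn0.
case: (leqP m n) => mn; last by rewrite big_geq //; lia.
by rewrite big_nat_recr //= IHn; case: leqP; lia.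
Qed.

(* The cells strictly below the path can be counted by columns, which gives the
   legs of the cells followed by an east step, or by rows, which gives the arms
   plus one of the cells followed by a north step. *)
Lemma sum_legs la (north : pred cell) (u : cell) p : is_partition la ->
    path ne_step u p -> last u p = (1, part la 1) ->
    path (fun v w => north v == (w.1 < v.1)) u p -> ~~ north (1, part la 1) ->
    {subset u :: p <= diagram la} ->
  \sum_(v <- u :: p) (conj_part la v.2 - v.1) =
  \sum_(v <- u :: p) north v * hook la v + below_area la u.
Proof.
move=> la_part; elim: p u => [|v p IHp] u.
  by move=> _ /= -> _ /negbTE nn _; rewrite !big_cons !big_nil nn
    /below_area big_nat1 /=; lia.
move=> /= /andP[uv vp] pl /andP[/eqP nu nvp] nn sub.
have sub' : {subset v :: p <= diagram la}.
  by move=> w wp; apply: sub; rewrite inE wp orbT.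
rewrite big_cons [in RHS]big_cons (IHp v) //.
have /and4P[u1 uL u2 uN] := diagram_box la_part (sub _ (mem_head _ _)).
have /and4P[v1 vL v2 vN] := diagram_box la_part (sub' _ (mem_head _ _)).
have := sub _ (mem_head _ _); rewrite mem_diagram => /and3P[_ _ up].
have := leq_part_conj la_part u1 u2; rewrite up => /esym cu.
case/orP: uv => /andP[/eqP e1 /eqP e2].
  have -> : north u by rewrite nu; lia.
  (* Going north adds row [u.1] from column [u.2] on: the arm of [u] plus one cell, which the leg of
     [u] completes to the hook. *)
  have -> : below_area la v = below_area la u + (part la u.1 + 1 - u.2).
    rewrite /below_area e2.
    transitivity (\sum_(u.2 <= k < (part la 1).+1)
        ((conj_part la k - u.1) + (k <= part la u.1))).
      apply: eq_big_nat => k kb.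
      have := @leq_part_conj la u.1 k la_part u1; lia.
    rewrite big_split /= sum_leq_nat; congr addn.
    have := part_anti la_part (isT : 0 < 1) u1; lia.
  rewrite /hook; lia.
have -> : north u = false by rewrite nu; lia.
have -> : below_area la u = conj_part la u.2 - u.1 + below_area la v.
  by rewrite /below_area e1 e2 big_ltn //; lia.
lia.
Qed.

(** * North steps as pairs of consecutive cells *)

Lemma path_infix (e : rel cell) u p :
  (forall v w, infix [:: v; w] (u :: p) -> e v w) -> path e u p.
Proof.
elim: p u => [//|v p IHp] u H /=; rewrite H /=; last by rewrite !eqxx prefix0s.
by apply: IHp => w w' ww'; apply: H; apply: infix_trans ww' (infix_cons _ _).
Qed.

Lemma infix_path (e : rel cell) u p v w :
  path e u p -> infix [:: v; w] (u :: p) -> e v w.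
Proof. by move=> up vw; have := infix_sorted vw up; rewrite /= andbT. Qed.

Lemma infix_succ_inj (s : seq cell) v w w' : uniq s ->
  infix [:: v; w] s -> infix [:: v; w'] s -> w = w'.
Proof.
move=> us; suff nthE x : infix [:: v; x] s -> x = nth v s (index v s).+1.
  by move=> /nthE-> /nthE->.
move=> /infixP[s1 [s2 sE]]; move: us; rewrite sE cat_uniq => /and3P[_ + _].
rewrite -all_predC /= => /andP[/= vs1 _].
rewrite index_cat (negbTE vs1) /= eqxx addn0 nth_cat ltnNge leqnSn /=.
by rewrite subSn // subnn.
Qed.

(** A path repeats no cell, so [w] is the only successor of [v] that [steps_north] can detect. *)
Lemma steps_north_infix (u v w : cell) p : path ne_step u p ->
  infix [:: v; w] (u :: p) -> steps_north (u :: p) v = (w.1 < v.1).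
Proof.
move=> up vw; have un := ne_path_uniq up; have := infix_path up vw.
rewrite /ne_step => vwE; apply/idP/idP => [north|wv].
  have wE := infix_succ_inj un vw north.
  by move: vwE; rewrite wE /=; lia.
rewrite /steps_north; suff <- : w = (v.1.-1, v.2) by [].
by rewrite [w]surjective_pairing; congr pair; lia.
Qed.

Lemma steps_north_path (u : cell) p : path ne_step u p ->
  path (fun v w => steps_north (u :: p) v == (w.1 < v.1)) u p.
Proof. by move=> up; apply: path_infix => v w vw; rewrite (steps_north_infix up vw). Qed.

(** * Outer corners and the rectangles between them *)

Lemma diagram_pairwise la :
  pairwise (fun u v : cell => u.1 <= v.1) (diagram la).
Proof.
suff H n a : pairwise (fun u v : cell => u.1 <= v.1)
    [seq (i, j) | i <- iota a n, j <- iota 1 (part la i)] by apply: H.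
elim: n a => [|n IHn] a //=.
rewrite pairwise_cat IHn andbT; apply/andP; split.
  apply/allrelP => u v /mapP[j _ ->] /allpairsPdep[i [k [+ _ ->]]].
  by rewrite mem_iota /=; lia.
by elim: (iota 1 _) => //= j s ->; rewrite andbT; apply/allP => u /mapP[k _ ->].
Qed.

Section Corners.
Variable la : seq nat.
Hypothesis la_part : is_partition la.

Lemma outer_cornerE (u : cell) : is_outer_corner la u =
  [&& 0 < u.1, 0 < u.2, u.2 == part la u.1 & u.1 == conj_part la u.2].
Proof.
rewrite /is_outer_corner !mem_diagram /=.
case: (posnP u.1) => //= u1; case: (posnP u.2) => //= u2.
by rewrite (@leq_part_conj la u.1.+1) // (leq_part_conj la_part u1 u2) -/(_ <= _);
  have := leq_part_conj la_part u1 u2; lia.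
Qed.

Lemma mem_outer_corners (u : cell) :
  (u \in outer_corners la) = is_outer_corner la u.
Proof.
by rewrite mem_rev mem_filter andb_idr // => /andP[].
Qed.

Lemma nth_corner k : 0 < k <= ncorners la ->
  is_outer_corner la (corner_row la k, corner_col la k).
Proof.
case: k => //= k km; rewrite /corner_row /corner_col /=.
rewrite !(nth_map (0, 0)) // -surjective_pairing -mem_outer_corners.
exact: mem_nth.
Qed.

Lemma outer_corner_rim u : is_outer_corner la u -> rim la u.
Proof.
case/and3P=> ula _; rewrite /rim ula /=; apply: contra => vla.
have := ula; rewrite mem_diagram => /and3P[u1 u2 _].
by apply: (diagram_down la_part vla) => /=; lia.
Qed.

(** The corner is the bottom cell of the column in which row [c.1] ends. Bounds at the corners thus
    bound every entry of the tableau. *)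
Lemma outer_corner_above (c : cell) : c \in diagram la ->
  exists2 k, 0 < k <= ncorners la &
    (c.1 <= corner_row la k) && (c.2 <= corner_col la k).
Proof.
rewrite mem_diagram => /and3P[c1 c2 cp].
pose j := part la c.1; pose i := conj_part la j.
have j0 : 0 < j by rewrite /j; lia.
have := leq_part_conj la_part c1 j0; rewrite leqnn -/i => /esym ic.
have i0 : 0 < i by lia.
have uo : (i, j) \in outer_corners la.
  rewrite mem_outer_corners outer_cornerE /= i0 j0 eqxx andbT /=.
  have := leq_part_conj la_part i0 j0; rewrite leqnn => ji.
  by have := part_anti la_part c1 ic; rewrite -/j; lia.
exists (index (i, j) (outer_corners la)).+1; first by rewrite /= index_mem.
rewrite /corner_row /corner_col /= !(nth_map (0, 0)) ?index_mem //.
by rewrite nth_index //= ic.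
Qed.

Lemma corner_row_anti k : 0 < k -> corner_row la k.+1 <= corner_row la k.
Proof.
case: k => // k _; rewrite /corner_row /=.
have [km|km] := ltnP k.+1 (ncorners la); last first.
  (* Past the last corner [corner_row] takes the default value 0. *)
  by rewrite nth_default // size_map.
rewrite !(nth_map (0, 0)) //; last by apply: ltnW.
have : sorted (fun u v : cell => v.1 <= u.1) (outer_corners la).
  rewrite rev_sorted; apply: sorted_filter; first by move=> v u w; lia.
  by rewrite sorted_pairwise ?diagram_pairwise // => v u w; lia.
by move=> /(sortedP (0, 0)); apply.
Qed.

(** A corner ends its row, and higher rows are at least as long. *)
Lemma corner_col_homo k : 0 < k <= ncorners la ->
  corner_col la k.-1 <= corner_col la k.
Proof.
case: k => // -[//|k] km.
have /nth_corner : 0 < k.+1 <= ncorners la by lia.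
have := nth_corner km; rewrite !outer_cornerE /= => /and4P[r2 _ /eqP-> _].
by move=> /and4P[_ _ /eqP-> _]; rewrite part_anti // corner_row_anti.
Qed.

End Corners.

(** The half-open intervals tile the large one, so [a] is in exactly one of them or in none. *)
Lemma sum_interval_anti (f : nat -> nat) a k n : k <= n ->
  (forall i, k <= i < n -> f i.+1 <= f i) ->
  \sum_(k <= i < n) (f i.+1 < a <= f i) = (f n < a <= f k).
Proof.
move=> kn fa.
suff: \sum_(k <= i < n) (f i.+1 < a <= f i) = (f n < a <= f k) /\ f n <= f k.
  by case.
elim: n kn fa => [|n IHn] kn fa; first by rewrite big_geq // (_ : k = 0); lia.
have [kn1|kn1] := leqP k n; last by rewrite big_geq // (_ : k = n.+1); lia.
have [|IH fk] := IHn kn1; first by move=> i ki; apply: fa; lia.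
by rewrite big_nat_recr //= IH; have := fa n; lia.
Qed.

Lemma sum_interval_homo (f : nat -> nat) a k :
  (forall j, 0 < j <= k -> f j.-1 <= f j) ->
  \sum_(1 <= j < k.+1) (f j.-1 < a <= f j) = (f 0 < a <= f k).
Proof.
move=> fh; suff: \sum_(1 <= j < k.+1) (f j.-1 < a <= f j) = (f 0 < a <= f k) /\
   f 0 <= f k by case.
elim: k fh => [|k IHk] fh; first by rewrite big_geq //; lia.
have [|IH fk] := IHk; first by move=> j jk; apply: fh; lia.
rewrite big_nat_recr //= IH; have := fh k.+1 => /=; lia.
Qed.

(** * The bounded sums as quadrant sums *)

(** Labels live on the finite type of cells of a list; extension by 0 allows sums over lists of
    cells. *)
Definition extend (S : seq cell) (f : seq_sub S -> nat) (v : cell) : nat :=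
  if insub v is Some s then f s else 0.

Lemma extendE S (f : seq_sub S -> nat) s : extend f (ssval s) = f s.
Proof. by rewrite /extend; have -> := valK s. Qed.

Lemma sum_seq_sub (S : seq cell) (P : pred cell) (F : cell -> nat) : uniq S ->
  \sum_(s : seq_sub S | P (ssval s)) F (ssval s) = \sum_(v <- S | P v) F v.
Proof.
move=> uS; rewrite -(big_map (@ssval _ S) P F); apply: perm_big.
rewrite uniq_perm ?map_inj_uniq ?index_enum_uniq //; first exact: val_inj.
move=> v; apply/mapP/idP => [[s _ ->]|vS]; first exact: ssvalP.
by exists (SeqSub vS); rewrite ?mem_index_enum.
Qed.

Definition total_label (gam : seq cell) (g : labelling gam) (v : cell) : nat :=
  extend g v + steps_north gam v.

Section Path.
Variable la : seq nat.
Hypothesis la_part : is_partition la.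
Variable gam : seq cell.
Hypothesis gam_uniq : uniq gam.
Hypothesis gam_la : {subset gam <= diagram la}.
Variable g : labelling gam.

Lemma region_sumE i j : subpath_weight la g i j + subpath_norths la gam i j =
  \sum_(v <- gam | in_region la i j v) total_label g v.
Proof.
rewrite big_split /=; congr addn.
  rewrite /subpath_weight.
  transitivity (\sum_(s : seq_sub gam | ssval s \in subpath la gam i j)
      extend g (ssval s)); first by apply: eq_bigr => s _; rewrite extendE.
  rewrite (sum_seq_sub (fun v => v \in subpath la gam i j) (extend g)) //.
  rewrite big_seq_cond [RHS]big_seq_cond; apply: eq_bigl => v.
  by rewrite mem_filter andbCA andbb andbC.
by rewrite /subpath_norths /subpath -sum1_count big_filter_cond
  big_mkcondr; apply: eq_bigr => v _; case: steps_north.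
Qed.

(** The rectangles with [i >= k] and [j <= k] tile the quadrant north-west of the [k]-th corner,
    since their row and column intervals tile its sides. *)
Lemma corner_sumE k : 0 < k <= ncorners la ->
  \sum_(k <= i < (ncorners la).+1) \sum_(1 <= j < k.+1)
     (subpath_weight la g i j + subpath_norths la gam i j) =
  quadrant_sum gam (total_label g) (corner_row la k, corner_col la k).
Proof.
move=> km.
transitivity (\sum_(k <= i < (ncorners la).+1) \sum_(1 <= j < k.+1)
    \sum_(v <- gam) in_region la i j v * total_label g v).
  apply: eq_bigr => i _; apply: eq_bigr => j _; rewrite region_sumE big_mkcond.
  by apply: eq_bigr => v _; case: in_region; rewrite ?mul1n.
under eq_bigr do rewrite exchange_big /=.
rewrite exchange_big /= /quadrant_sum [RHS]big_mkcond big_seq [RHS]big_seq.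
apply: eq_bigr => v /gam_la; rewrite mem_diagram => /and3P[v1 v2 _].
under eq_bigr do rewrite -big_distrl /=.
rewrite -big_distrl /=.
have -> : \sum_(k <= i < (ncorners la).+1) \sum_(1 <= j < k.+1)
    in_region la i j v =
    (\sum_(k <= i < (ncorners la).+1)
       (corner_row la i.+1 < v.1 <= corner_row la i)) *
    \sum_(1 <= j < k.+1) (corner_col la j.-1 < v.2 <= corner_col la j).
  rewrite big_distrl /=; apply: eq_bigr => i _; rewrite big_distrr /=.
  by apply: eq_bigr => j _; rewrite mulnb.
rewrite sum_interval_anti; last 2 first.
- by lia.
- by move=> i ki; apply: corner_row_anti; lia.
rewrite sum_interval_homo; last first.
  by move=> j jk; apply: corner_col_homo => //; lia.
have -> : corner_row la (ncorners la).+1 = 0.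
  by rewrite /corner_row nth_default // size_map.
rewrite (_ : corner_col la 0 = 0) // v1 v2 /= mulnb.
by case: ifP; rewrite ?mul1n.
Qed.

End Path.

Lemma quadrant_sum_mono gam A (c d : cell) : c.1 <= d.1 -> c.2 <= d.2 ->
  quadrant_sum gam A c <= quadrant_sum gam A d.
Proof.
move=> cd1 cd2; rewrite /quadrant_sum big_mkcond [leqRHS]big_mkcond.
by apply: leq_sum => v _; case: ifP; case: ifP => //; lia.
Qed.

(** * The weight of a labelled path *)

Section LatticePath.
Variables la : seq nat.
Hypothesis la_part : is_partition la.
Let u : cell := (conj_part la 1, 1).
Variable p : seq cell.
Hypothesis up : path ne_step u p.
Hypothesis pl : last u p = (1, part la 1).
Hypothesis gam_la : {subset u :: p <= diagram la}.
Variable g : labelling (u :: p).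

(** Double counting: the label of [v] enters once for each rim cell south-east of [v], that is,
    [hook la v] times. The north steps then contribute the area by [sum_legs]. *)
Lemma area_hook_weight S : uniq S -> S =i rim la ->
  \sum_(c <- S) quadrant_sum (u :: p) (total_label g) c =
  path_area la (u :: p) + hook_weight la g.
Proof.
move=> uS S_rim; have gam_uniq := ne_path_uniq up.
rewrite /quadrant_sum; under eq_bigr do rewrite big_mkcond.
rewrite exchange_big /=.
transitivity (\sum_(v <- u :: p) total_label g v * hook la v).
  rewrite big_seq [RHS]big_seq; apply: eq_bigr => v /gam_la vla.
  rewrite -(count_rim_hook la_part uS S_rim vla) -big_mkcond.
  by rewrite big_const_seq iter_addn_0.
rewrite /total_label; under eq_bigr do rewrite mulnDl.
rewrite big_split /= addnC; congr addn; last first.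
  rewrite -(@sum_seq_sub _ xpredT (fun v => extend g v * hook la v)) //.
  by apply: eq_bigr => s _; rewrite extendE.
rewrite /path_area (sum_legs la_part up pl (steps_north_path up)) //.
  (* The path starts at the bottom of column 1, so no cell of [la] lies below it. *)
  rewrite [X in _ = _ + X](_ : _ = 0) ?addn0 // /below_area big1_seq // => k.
  rewrite mem_index_iota /= => k1.
  by have := @conj_anti _ la_part 1 k; lia.
(* A north step from row 1 would put a cell of row 0 on the path. *)
apply/negP => /mem_infix/(_ (0, part la 1)); rewrite !inE eqxx orbT => /(_ isT).
by rewrite -in_cons => /gam_la; rewrite mem_diagram.
Qed.

End LatticePath.

(** * The bijection between tableaux and labelled paths *)

Section Bijection.
Variables (la mu : seq nat) (M : nat).
Hypothesis strip : border_strip la mu.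
Hypothesis M_gt0 : 0 < M.
Let L := conj_part la 1.
Let N := part la 1.

Let la_part : is_partition la. Proof. by case: strip => -[]. Qed.

Let skewE (c : cell) : (c \in skew_cells la mu) = rim la c.
Proof. exact: border_strip_rim strip c. Qed.

Let la_gt0 : 0 < N.
Proof.
case: strip => _ [_ _ _]; rewrite skewE => /andP[+ _].
by rewrite mem_diagram => /and3P[].
Qed.

Let L_gt0 : 0 < L.
Proof. by rewrite -leq_part_conj. Qed.

Implicit Type T : filling la mu M.

Definition entries T : cell -> nat := extend (fun s => T s : nat).

(** A path from [(L, 1)] to [(1, N)] has [(L + N).-1] cells. *)
Definition strip_path T : seq cell :=
  traject (next_cell (col_profile la (entries T)) (row_profile la (entries T)))
    (L, 1) (L + N).-1.

(** The path is a separate parameter because the type of labellings depends on it: tableaux with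
    equal paths get comparable labels. *)
Definition strip_label (gam : seq cell) T : labelling gam :=
  [ffun s => overlap (col_profile la (entries T)) (row_profile la (entries T))
     (ssval s) - steps_north gam (ssval s)].

Lemma entriesE T c (cS : c \in skew_cells la mu) : entries T c = T (SeqSub cS).
Proof. exact: (extendE _ (SeqSub cS)). Qed.

Lemma rim_ltM T c : rim la c -> entries T c < M.
Proof. by rewrite -skewE => cS; rewrite -[c]/(ssval (SeqSub cS)) /entries extendE. Qed.

Lemma entries_inj T1 T2 : (forall c, rim la c -> entries T1 c = entries T2 c) ->
  T1 = T2.
Proof.
move=> T12; apply/ffunP => s; apply/val_inj.
by have := T12 (ssval s); rewrite -skewE ssvalP /entries !extendE; apply.
Qed.

Lemma semistandard_rim T : semistandard T -> rim_tableau la (entries T).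
Proof.
move=> /forallP sT.
have H c d (cS : c \in skew_cells la mu) (dS : d \in skew_cells la mu) :
    ((c.1 == d.1) && (c.2 < d.2) ==> (entries T c <= entries T d)) &&
    ((c.2 == d.2) && (c.1 < d.1) ==> (entries T c < entries T d)).
  have /forallP := sT (SeqSub cS) => /(_ (SeqSub dS)).
  by rewrite (entriesE T cS) (entriesE T dS).
split=> i j; rewrite -!skewE => cS dS; have /andP[] := H _ _ cS dS => /=.
  by rewrite eqxx ltnSn.
by rewrite eqxx ltnSn.
Qed.

Lemma strip_path_cons T : strip_path T = (L, 1) :: behead (strip_path T).
Proof.
rewrite /strip_path; have -> : (L + N).-1 = (L + N).-2.+1 by lia.
by [].
Qed.

Lemma strip_path_visited T : semistandard T ->
  let C := col_profile la (entries T) in let D := row_profile la (entries T) in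
  [/\ fpath (next_cell C D) (L, 1) (behead (strip_path T)),
      last (L, 1) (behead (strip_path T)) = (1, N)
    & all (visited la C D) (strip_path T)].
Proof.
move=> sT C D; have CD := tableau_profile la_part la_gt0 (semistandard_rim sT).
have vis : visited la C D (L, 1).
  case: (CD) => -[C0 DL CN] [Dd D01 Cm CDrim].
  have L1 : (L, 1) \in diagram la by rewrite mem_diagram /= L_gt0 leq_part_conj // leqnn.
  rewrite /visited L1 /= [D L]DL leq0n /= [C 0]C0.
  have [//|L1'] := eqVneq L 1; have := Dd L; rewrite [row_profile la _ L]DL -/D.
  rewrite -/L; lia.
have LN : (L, 1).1 + N = (L + N).-2.+1 + (L, 1).2 by rewrite /=; lia.
have := walk_ends la_part CD vis LN.
have -> : strip_path T = traject (next_cell C D) (L, 1) (L + N).-2.+1.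
  by rewrite /strip_path; congr traject; lia.
by move=> /= [-> ->]; rewrite fpath_traject.
Qed.

Lemma strip_path_lattice T : semistandard T -> lattice_paths la (strip_path T).
Proof.
move=> sT; have [pn pl pv] := strip_path_visited sT.
exists (behead (strip_path T)); split=> //; first exact: strip_path_cons.
  exact: fpath_ne pn.
by move=> c /(allP pv) /and3P[].
Qed.

(** The subtraction in [strip_label] is not truncated: a north step leaves a cell of positive
    overlap, by the strict inequalities in [visited] and [profile]. *)
Lemma strip_labelK T : semistandard T ->
  let gam := strip_path T in
  forall v : cell, v \in gam -> total_label (strip_label gam T) v =
    overlap (col_profile la (entries T)) (row_profile la (entries T)) v.
Proof.
move=> sT gam v vgam; have [pn pl pv] := strip_path_visited sT.
rewrite /total_label -[v in extend _ v]/(ssval (SeqSub vgam)) extendE ffunE /=.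
rewrite subnK //; case north: (steps_north gam v) => //.
move: north; rewrite /steps_north {1}/gam strip_path_cons => /(infix_path pn) /= /eqP.
rewrite /next_cell; case: ifP => [/andP[v1 DC] _|_ []]; last by lia.
have := allP pv _ vgam => /and3P[/(diagram_box la_part) box Dv Cv].
have [_ [Dd _ _ _]] := tableau_profile la_part la_gt0 (semistandard_rim sT).
by have := Dd v.1; rewrite /overlap; lia.
Qed.

(** Both sides are C - D on the rim, and [walk_sums] identifies the margins of the path with those
    read off [T]. *)
Lemma strip_quadrant T : semistandard T -> forall c, rim la c ->
  entries T c =
  quadrant_sum (strip_path T) (total_label (strip_label (strip_path T) T)) c.
Proof.
move=> sT c cr; have [pn pl pv] := strip_path_visited sT.
have tT := semistandard_rim sT; have CD := tableau_profile la_part la_gt0 tT.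
have gam_la : {subset strip_path T <= diagram la}.
  by move=> v /(allP pv) /and3P[].
have := quadrant_sumE (total_label (strip_label (strip_path T) T)) la_part gam_la cr.
have := tableau_profileE la_part la_gt0 tT cr.
suff [-> ->] :
    rows_sum (strip_path T) (total_label (strip_label (strip_path T) T)) c.1 =
      row_profile la (entries T) c.1 /\
    cols_sum (strip_path T) (total_label (strip_label (strip_path T) T)) c.2 =
      col_profile la (entries T) c.2 by lia.
have eq_sum (P : pred cell) :
    \sum_(v <- strip_path T | P v) total_label (strip_label (strip_path T) T) v =
    \sum_(v <- strip_path T | P v)
      overlap (col_profile la (entries T)) (row_profile la (entries T)) v.
  rewrite big_seq_cond [RHS]big_seq_cond; apply: eq_bigr => v /andP[vgam _].
  exact: strip_labelK.
rewrite /rows_sum /cols_sum !eq_sum.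
have [] := walk_sums la_part CD pn pl; first by rewrite -strip_path_cons.
rewrite -strip_path_cons /= => rE cE.
have /(diagram_box la_part) box : c \in diagram la by case/andP: cr.
case: (CD) => -[C0 DL _] _; rewrite -/L in DL.
split; last by have := cE c.2; rewrite /cols_sum -/N C0 DL; lia.
(* [walk_sums] covers the rows above [L] only; below row [L] both sums vanish. *)
have [cL|cL] := ltnP c.1 L; first by have := rE _ cL; rewrite /rows_sum C0 DL; lia.
have -> : c.1 = L by lia.
rewrite DL big_seq_cond big_pred0 // => v.
by apply/negP => /andP[/gam_la /(diagram_box la_part)]; lia.
Qed.

(** Surjectivity: the quadrant sums of the labelled path form the tableau, and [walk_unique]
    recovers the path and its labels from it. *)
Lemma lattice_path_strip (gam : seq cell) (g : labelling gam) :
    lattice_paths la gam -> admissible la M gam g ->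
  exists T, [/\ semistandard T, strip_path T = gam & strip_label gam T = g].
Proof.
move=> [p [gamE up pl gam_la]] adm.
have gam_uniq : uniq gam by rewrite gamE ne_path_uniq.
pose A := total_label g; pose Q := quadrant_sum gam A.
have Q_lt c : rim la c -> Q c < M.
  case/andP => cla _; have [k km /andP[ck1 ck2]] := outer_corner_above la_part cla.
  apply: leq_ltn_trans (adm k km); rewrite corner_sumE //.
  exact: quadrant_sum_mono.
(* The default of [insubd] is never reached, by [Q_lt]. *)
pose T : filling la mu M := [ffun s => insubd (Ordinal M_gt0) (Q (ssval s))].
have TE c : rim la c -> entries T c = Q c.
  move=> cr; have cS : c \in skew_cells la mu by rewrite skewE.
  rewrite -[c in LHS]/(ssval (SeqSub cS)) /entries extendE ffunE.
  by rewrite val_insubd /= Q_lt.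
have north_pos : path (fun v w => (w.1 < v.1) ==> (0 < A v)) (L, 1) p.
  have : path (fun v w => steps_north gam v == (w.1 < v.1)) (L, 1) p.
    by rewrite gamE; apply: steps_north_path.
  apply: sub_path => v w /eqP vw; apply/implyP => wv.
  by rewrite /A /total_label vw wv addn1.
have QE c : rim la c -> Q c + rows_sum gam A c.1 = cols_sum gam A c.2.
  by move=> cr; apply: (quadrant_sumE A la_part gam_la cr).
have [rowE colE] := quadrant_sum_profile la_part la_gt0 gam_la TE.
have sT : semistandard T.
  apply/forallP => s; apply/forallP => s'.
  have := ssvalP s; have := ssvalP s'; rewrite !skewE => s'r sr.
  have := TE _ sr; have := TE _ s'r; rewrite /entries !extendE => -> ->.
  apply/andP; split; apply/implyP => /andP[/eqP e lt].
    by apply: quadrant_sum_mono; rewrite ?e // ltnW.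
  have := QE _ sr; have := QE _ s'r; rewrite e => <-.
  (* Within a column C is constant, so strict descent of D makes the entries strictly increase. *)
  have rows_lt (c d : cell) : rim la c -> rim la d -> c.1 < d.1 ->
      rows_sum gam A d.1 < rows_sum gam A c.1.
    move=> /andP[/(diagram_box la_part) cb _] /andP[/(diagram_box la_part) db _] cd.
    apply: leq_trans (@rows_sum_anti gam A _ d.1.-1 _); last by lia.
    rewrite -{1}[d.1]prednK; last by lia.
    by rewrite gamE; apply: rows_sum_lt; rewrite // ?pl /= -/L; lia.
  have := rows_lt _ _ sr s'r lt; lia.
have box (v : cell) : v \in gam -> [&& 0 < v.1, v.1 <= L, 0 < v.2 & v.2 <= N].
  by move=> /gam_la /(diagram_box la_part).
(* No cell precedes the start, hence the offset 0. *)
have [||||pn ov] := @walk_unique A N 0 (col_profile la (entries T))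
    (row_profile la (entries T)) (L, 1) p up pl north_pos.
- by rewrite -gamE => v /box; lia.
- by move=> i iL; rewrite rowE ?gamE //; apply: ltnW.
- by move=> j /andP[_ jN]; rewrite colE ?gamE.
- have sum0 (P : pred cell) : (forall v, v \in gam -> P v -> False) ->
      \sum_(v <- gam | P v) A v = 0.
    move=> P0; rewrite big_seq_cond big_pred0 // => v.
    by apply/negP => /andP[/P0].
  by rewrite colE // rowE // /rows_sum /cols_sum !sum0 // => v /box /=; lia.
have TE' : strip_path T = gam.
  rewrite /strip_path; have -> : (L + N).-1 = (size p).+1.
    by have := ne_path_size up; rewrite pl /= -/N -/L; lia.
  by rewrite gamE /= -(fpathE pn).
exists T; split=> //; apply/ffunP => s; rewrite ffunE ov -?gamE ?ssvalP //.
by rewrite /A /total_label extendE addnK.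
Qed.

Lemma strip_label_inj (gam : seq cell) T1 T2 :
    semistandard T1 -> semistandard T2 -> strip_path T1 = gam ->
    strip_path T2 = gam -> strip_label gam T1 = strip_label gam T2 ->
  T1 = T2.
Proof.
move=> s1 s2 <- e12 lab12; apply: entries_inj => c cr.
by rewrite (strip_quadrant s1 cr) (strip_quadrant s2 cr) e12 lab12.
Qed.

(** The sum bounded at the [k]-th corner is an entry of [T]. *)
Lemma strip_label_admissible T : semistandard T ->
  admissible la M (strip_path T) (strip_label (strip_path T) T).
Proof.
move=> sT k km; have [pn pl pv] := strip_path_visited sT.
have gam_la : {subset strip_path T <= diagram la}.
  by move=> v /(allP pv) /and3P[].
have gam_uniq : uniq (strip_path T).
  by rewrite strip_path_cons (ne_path_uniq (fpath_ne pn)).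
have kr := outer_corner_rim la_part (nth_corner km).
by rewrite corner_sumE // -(strip_quadrant sT kr) rim_ltM.
Qed.

Lemma strip_weight T (gam : seq cell) : semistandard T -> strip_path T = gam ->
  \sum_(s : seq_sub (skew_cells la mu)) T s =
  path_area la gam + hook_weight la (strip_label gam T).
Proof.
move=> sT <-; have [p [gamE up pl gam_la]] := strip_path_lattice sT.
have Suniq := skew_cells_uniq la mu.
transitivity (\sum_(c <- skew_cells la mu) entries T c).
  rewrite -(@sum_seq_sub _ xpredT (entries T)) //; apply: eq_bigr => s _.
  by rewrite /entries extendE.
transitivity (\sum_(c <- skew_cells la mu)
    quadrant_sum (strip_path T) (total_label (strip_label (strip_path T) T)) c).
  rewrite big_seq [RHS]big_seq; apply: eq_bigr => c; rewrite skewE.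
  exact: strip_quadrant.
(* The labelling is generalized because its type mentions the path being rewritten. *)
move: (strip_label _ _); rewrite {}gamE in gam_la *.
by move=> g; apply: area_hook_weight.
Qed.

End Bijection.

(** * Summation over tableaux, grouped by their paths *)

Import GRing.Theory.
Local Open Scope ring_scope.

Theorem proposition8p5 (R : comNzRingType) (q : R) (la mu : seq nat) (M : nat)
    (hstrip : border_strip la mu) (hM : (0 < M)%N) :
  skew_schur la mu (fun k : 'I_M => q ^+ k) =
  \sum_(gam \in lattice_paths la)
     q ^+ path_area la gam *
     \sum_(g \in admissible la M gam) q ^+ hook_weight la g.
Proof.
pose sst := [pred T : filling la mu M | semistandard T].
(* For a fixed path, the admissible labellings are exactly those of the tableaux with this path,
   each obtained once. *)
have pathE gam : lattice_paths la gam ->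
    q ^+ path_area la gam *
      \sum_(g \in admissible la M gam) q ^+ hook_weight la g =
    \sum_(T in sst | strip_path T == gam) \prod_u q ^+ T u.
  move=> gam_path.
  pose r := [seq strip_label gam T | T <- enum [pred T in sst | strip_path T == gam]].
  have r_uniq : uniq r.
    rewrite map_inj_in_uniq ?enum_uniq // => T1 T2; rewrite !mem_enum !inE.
    move=> /andP[s1 /eqP p1] /andP[s2 /eqP p2].
    exact: (strip_label_inj hstrip hM s1 s2 p1 p2).
  have -> : admissible la M gam = [set` r]%classic.
    apply/seteqP; split=> g /=.
      move=> /(lattice_path_strip hstrip hM gam_path)[T [sT pT lT]].
      by apply/mapP; exists T; rewrite ?mem_enum ?inE ?sT ?pT /=.
    move=> /mapP[T + ->]; rewrite mem_enum !inE => /andP[sT /eqP <-].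
    exact: strip_label_admissible.
  rewrite -fsbig_seq // big_map big_enum_cond /= big_distrr /=.
  apply: eq_big => [T|T]; rewrite andbT // => /andP[sT /eqP pT].
  by rewrite -exprD -(strip_weight hstrip hM sT pT) -prodrXr.
(* A finite list carrying the sum over paths: any other path has an empty sum of tableaux. *)
pose r := undup [seq strip_path T | T in sst].
rewrite (fsbigE r) ?undup_uniq //; first last.
- move=> gam /pathE ->; rewrite mem_undup => gamr.
  rewrite big_pred0 // => T; apply/negP => /andP[sT /eqP pT].
  by case/negP: gamr; rewrite -pT fintype.image_f.
- move=> gam /=; rewrite mem_undup => /fintype.imageP[T sT ->].
  by apply: strip_path_lattice.
rewrite (eq_bigr (fun gam => \sum_(T in sst | strip_path T == gam)
    \prod_u q ^+ T u)) => [|gam]; last by rewrite inE; apply: pathE.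
(* After the exchange, each tableau is counted for its own path only. *)
rewrite (exchange_big_dep (mem sst)) /=; last by move=> gam T _ /andP[].
rewrite /skew_schur; apply: eq_bigr => T sT; symmetry.
rewrite (eq_bigl (pred1 (strip_path T))) => [|gam].
  rewrite -big_filter filter_pred1_uniq ?undup_uniq ?big_seq1 //.
  by rewrite mem_undup fintype.image_f.
rewrite /= (_ : T \in sst) //= eq_sym andb_idl // => /eqP->; rewrite inE.
exact: strip_path_lattice.
Qed.
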